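(* Let $R$ be a commutative Noetherian ring. Then $R$ has the Weierstrass property if and only if $R$ is isomorphic to a finite product of complete local Noetherian rings.
   Context: All rings are commutative with a nonzero identity. A ring $R$ has the Weierstrass property if, whenever $n\ge 0$ and $f(x)=a_0+a_1x+a_2x^2+\cdots\in R[[x]]$ are such that $a_0,\ldots,a_n$ generate the unit ideal of $R$, there are a monic polynomial $p(x)\in R[x]$ of degree $n$ and a unit $u(x)$ of $R[[x]]$ such that $f(x)=p(x)u(x)$. A local ring $R$ with maximal ideal $P$ is called complete if the natural map $R\to\widehat{R}=\varprojlim_n R/P^n$ is an isomorphism. *)

(* Defs.v *)
From HB Require Import structures.
From mathcomp Require Import all_boot all_order all_algebra.
From mathcomp Require Import generic_quotient ring_quotient.
From mathcomp Require Import boolp classical_sets.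

Set Implicit Arguments.
Unset Strict Implicit.
Unset Printing Implicit Defensive.

Import GRing.Theory.
Local Open Scope quotient_scope.
Local Open Scope classical_set_scope.
Local Open Scope ring_scope.

Section Ideals.
Variable R : comNzRingType.

Definition ideal (I : set R) : Prop :=
  [/\ I 0, forall x y, I x -> I y -> I (x + y) & forall a x, I x -> I (a * x)].

Definition generated (n : nat) (a : 'I_n -> R) : set R :=
  [set x | exists c : 'I_n -> R, x = \sum_(i < n) c i * a i].

Definition noetherian : Prop :=
  forall I : set R, ideal I -> exists n (a : 'I_n -> R), I = generated a.

Definition maximal_ideal (M : set R) : Prop :=
  [/\ ideal M, M <> setT
    & forall J : set R, ideal J -> M `<=` J -> J <> setT -> J = M].

(* The library's [idealr R] is the type of proper ideals of [R]. *)
Definition local_with_maximal_ideal (P : idealr R) : Prop :=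
  maximal_ideal [set` P] /\ forall M : set R, maximal_ideal M -> M = [set` P].

End Ideals.

Section IdealPowers.
Variables (R : comNzRingType) (P : idealr R).

(* [idealX P n] is P^n, the ideal generated by the n-fold products of elements
   of P; in particular P^0 is the unit ideal. *)
Definition idealX (n : nat) : R -> bool := fun x =>
  `[< exists k (c : 'I_k -> R) (y : 'I_k -> 'I_n -> R),
        (forall i j, y i j \in P) /\
        x = \sum_(i < k) c i * \prod_(j < n) y i j >].

Lemma idealX_closed n : idealr_closed (idealX n.+1).
Proof.
split.
- apply/asboolP; exists 0%N, (fun=> 0), (fun _ _ => 0).
  by split=> [[]//|]; rewrite big_ord0.
- apply/negP=> /asboolP[k [c [y [yP e]]]].
  have : 1 \in P.
    rewrite e rpred_sum// => i _; rewrite big_ord_recl mulrCA mulrC.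
    by rewrite idealMr.
  by rewrite idealr1.
- move=> a u v /asboolP[k [c [y [yP ->]]]] /asboolP[l [d [z [zP ->]]]].
  apply/asboolP; exists (k + l)%N,
    (fun i => match split i with inl i => a * c i | inr i => d i end),
    (fun i => match split i with inl i => y i | inr i => z i end).
  split=> [i j|]; first by case: split.
  rewrite big_split_ord/= mulr_sumr; congr (_ + _); apply: eq_bigr => i _.
    by rewrite (unsplitK (inl i)) mulrA.
  by rewrite (unsplitK (inr i)).
Qed.

HB.instance Definition _ n := isIdealr.Build R (idealX n.+1) (idealX_closed n).

(* The positive power P^(n+1), bundled as a proper ideal. *)
Definition idealXS (n : nat) : idealr R := idealX n.+1.

Lemma sub_idealX n x : x \in idealX n.+1 -> x \in idealX n.
Proof.
case/asboolP=> k [c [y [yP ->]]]; apply/asboolP.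
exists k, (fun i => c i * y i ord0), (fun i j => y i (lift ord0 j)).
by split=> [i j|]; rewrite ?yP//; under eq_bigr do rewrite big_ord_recl mulrA.
Qed.

End IdealPowers.

Section QuotientMap.
Variables (R : comNzRingType) (I J : idealr R).

(* The map R/I -> R/J induced by the identity of R, when I is contained in J. *)
Definition quot_map (q : {ideal_quot I}) : {ideal_quot J} :=
  \pi_({ideal_quot J}) (repr q).

Lemma quot_mapE : {subset I <= J} ->
  forall x, quot_map (\pi_({ideal_quot I}) x) = \pi_({ideal_quot J}) x.
Proof.
move=> sIJ x; apply/eqP; rewrite /quot_map -Quotient.idealrBE sIJ//.
by rewrite Quotient.idealrBE reprK.
Qed.

Lemma quot_map1 : {subset I <= J} -> quot_map 1 = 1.
Proof. by move=> s; rewrite -[in LHS](rmorph1 \pi_({ideal_quot I})) quot_mapE ?rmorph1. Qed.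

Lemma quot_mapB : {subset I <= J} -> {morph quot_map : x y / x - y}.
Proof.
move=> s x y; rewrite -[x]reprK -[y]reprK -rmorphB !quot_mapE//.
by rewrite rmorphB.
Qed.

Lemma quot_mapM : {subset I <= J} -> {morph quot_map : x y / x * y}.
Proof.
move=> s x y; rewrite -[x]reprK -[y]reprK -rmorphM !quot_mapE//.
by rewrite rmorphM.
Qed.

End QuotientMap.

Definition prod_ring (I : Type) (A : I -> comPzRingType) : Type := forall i, A i.

Section ProdRing.
Variables (I : Type) (A : I -> comPzRingType).
Local Notation T := (prod_ring A).

HB.instance Definition _ := gen_eqMixin T.
HB.instance Definition _ := gen_choiceMixin T.

Let zero : T := fun=> 0.
Let opp (x : T) : T := fun i => - x i.
Let add (x y : T) : T := fun i => x i + y i.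
Let one : T := fun=> 1.
Let mul (x y : T) : T := fun i => x i * y i.

Let addA : associative add.
Proof. by move=> x y z; apply: functional_extensionality_dep => i; apply: addrA. Qed.
Let addC : commutative add.
Proof. by move=> x y; apply: functional_extensionality_dep => i; apply: addrC. Qed.
Let add0 : left_id zero add.
Proof. by move=> x; apply: functional_extensionality_dep => i; apply: add0r. Qed.
Let addN : left_inverse zero opp add.
Proof. by move=> x; apply: functional_extensionality_dep => i; apply: addNr. Qed.

HB.instance Definition _ := GRing.isZmodule.Build T addA addC add0 addN.

Let mulA : associative mul.
Proof. by move=> x y z; apply: functional_extensionality_dep => i; apply: mulrA. Qed.
Let mulC : commutative mul.
Proof. by move=> x y; apply: functional_extensionality_dep => i; apply: mulrC. Qed.
Let mul1 : left_id one mul.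
Proof. by move=> x; apply: functional_extensionality_dep => i; apply: mul1r. Qed.
Let mulD : left_distributive mul add.
Proof. by move=> x y z; apply: functional_extensionality_dep => i; apply: mulrDl. Qed.

HB.instance Definition _ :=
  GRing.Zmodule_isComPzRing.Build T mulA mulC mul1 mulD.

End ProdRing.

Section Completion.
Variables (R : comNzRingType) (P : idealr R).

(* The inverse system is indexed from R/P^1 on: the omitted term R/P^0 is the
   zero ring, and does not affect the limit. *)
Definition adic_quot (n : nat) : comPzRingType := {ideal_quot (idealXS P n)}.

Definition adic_coherent : {pred prod_ring adic_quot} := fun z : prod_ring adic_quot =>
  `[< forall n, quot_map (idealXS P n) (z n.+1) = z n :> adic_quot n >].

Lemma adic_coherent_closed : subring_closed adic_coherent.
Proof.
split.
- by apply/asboolP=> n; apply: quot_map1 => x /sub_idealX.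
- move=> x y /asboolP hx /asboolP hy; apply/asboolP => n.
  have := quot_mapB (@sub_idealX _ P n.+1) (x n.+1) (y n.+1).
  by rewrite hx hy.
- move=> x y /asboolP hx /asboolP hy; apply/asboolP => n.
  have := quot_mapM (@sub_idealX _ P n.+1) (x n.+1) (y n.+1).
  by rewrite hx hy.
Qed.

HB.instance Definition _ :=
  GRing.isSubringClosed.Build (prod_ring adic_quot) adic_coherent
    adic_coherent_closed.

Record completion : Type := Completion {
  completion_val : prod_ring adic_quot;
  _ : completion_val \in adic_coherent
}.

HB.instance Definition _ := [isSub for completion_val].
HB.instance Definition _ := [Choice of completion by <:].
HB.instance Definition _ := GRing.SubChoice_isSubComPzRing.Build
  (prod_ring adic_quot) adic_coherent completion adic_coherent_closed.

Lemma completion_map_subproof (x : R) :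
  ((fun n => \pi_({ideal_quot (idealXS P n)}) x) : prod_ring adic_quot)
    \in adic_coherent.
Proof. by apply/asboolP=> n; apply: quot_mapE => y /sub_idealX. Qed.

Definition completion_map (x : R) : completion :=
  Completion (completion_map_subproof x).

Lemma completion_map_is_zmod_morphism : zmod_morphism completion_map.
Proof.
move=> x y; apply: val_inj; rewrite rmorphB /=.
by apply: functional_extensionality_dep => n; apply: rmorphB.
Qed.

Lemma completion_map_is_monoid_morphism : monoid_morphism completion_map.
Proof.
split=> [|x y]; apply: val_inj; rewrite ?rmorph1 ?rmorphM /=;
  apply: functional_extensionality_dep => n;
  [exact: rmorph1 | exact: rmorphM].
Qed.

HB.instance Definition _ := GRing.isZmodMorphism.Build R completion
  completion_map completion_map_is_zmod_morphism.
HB.instance Definition _ := GRing.isMonoidMorphism.Build R completion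
  completion_map completion_map_is_monoid_morphism.

End Completion.

Definition complete_local (R : comNzRingType) : Prop :=
  exists P : idealr R,
    local_with_maximal_ideal P /\ bijective (completion_map P).

Definition ring_isomorphic (R S : comPzRingType) : Prop :=
  exists f : {rmorphism R -> S}, bijective f.

Record powerseries (R : Type) : Type := PowerSeries { pscoef :> nat -> R }.

Section PowerSeries.
Variable R : comNzRingType.
Local Notation T := (powerseries R).

HB.instance Definition _ := gen_eqMixin T.
HB.instance Definition _ := gen_choiceMixin T.

Lemma psP (f g : T) : (forall n, f n = g n) -> f = g.
Proof. by case: f g => f [g] /= e; congr PowerSeries; apply/funext. Qed.

Definition ps_poly (p : {poly R}) : T := PowerSeries (fun n => p`_n).

Let zero : T := PowerSeries (fun=> 0).
Let opp (f : T) : T := PowerSeries (fun n => - f n).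
Let add (f g : T) : T := PowerSeries (fun n => f n + g n).
Let one : T := PowerSeries (fun n => (n == 0%N)%:R).

Definition ps_mul (f g : T) : T :=
  PowerSeries (fun n => \sum_(i < n.+1) f i * g (n - i)%N).

Let addA : associative add.
Proof. by move=> f g h; apply: psP => n; apply: addrA. Qed.
Let addC : commutative add.
Proof. by move=> f g; apply: psP => n; apply: addrC. Qed.
Let add0 : left_id zero add.
Proof. by move=> f; apply: psP => n; apply: add0r. Qed.
Let addN : left_inverse zero opp add.
Proof. by move=> f; apply: psP => n; apply: addNr. Qed.

HB.instance Definition _ := GRing.isZmodule.Build T addA addC add0 addN.

Let trunc N (f : T) : {poly R} := \poly_(i < N) f i.

Let coef_trunc N f i : (i < N)%N -> (trunc N f)`_i = f i.
Proof. by move=> iN; rewrite coef_poly iN. Qed.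

Let coef_truncM N f g n : (n < N)%N ->
  (trunc N f * trunc N g)`_n = ps_mul f g n.
Proof.
move=> nN; rewrite coefM; apply: eq_bigr => i _.
rewrite !coef_trunc// ?(leq_ltn_trans _ nN) ?leq_subr//.
by rewrite -ltnS.
Qed.

Let mulC : commutative ps_mul.
Proof.
by move=> f g; apply: psP => n; rewrite -!(@coef_truncM n.+1)// mulrC.
Qed.

Let mulA : associative ps_mul.
Proof.
move=> f g h; apply: psP => n.
transitivity ((trunc n.+1 f * (trunc n.+1 g * trunc n.+1 h))`_n).
  rewrite coefM; apply: eq_bigr => i _.
  by rewrite coef_trunc// coef_truncM// ltnS leq_subr.
rewrite mulrA coefM; apply: eq_bigr => i _.
by rewrite coef_truncM// coef_trunc// ltnS leq_subr.
Qed.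

Let mul1 : left_id one ps_mul.
Proof.
move=> f; apply: psP => n /=; rewrite big_ord_recl /= mul1r subn0.
by rewrite big1 ?addr0// => i _; rewrite mul0r.
Qed.

Let mulD : left_distributive ps_mul add.
Proof.
move=> f g h; apply: psP => n /=; rewrite -big_split.
by apply: eq_bigr => i _; rewrite mulrDl.
Qed.

Let one_neq0 : one != zero.
Proof.
apply/eqP=> /(congr1 (fun f : T => f 0%N)) /= /eqP.
by rewrite oner_eq0.
Qed.

HB.instance Definition _ :=
  GRing.Zmodule_isComNzRing.Build T mulA mulC mul1 mulD one_neq0.

End PowerSeries.

Definition is_unit (R : comNzRingType) (u : R) : Prop := exists v, u * v = 1.

Definition weierstrass_property (R : comNzRingType) : Prop :=
  forall (n : nat) (f : powerseries R),
    generated (fun i : 'I_n.+1 => f i) = setT ->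
    exists (p : {poly R}) (u : powerseries R),
      [/\ p \is monic, size p = n.+1, is_unit u & f = ps_poly p * u].

(* Main.v *)
(* If R has the Weierstrass property then, for every a and b_2, b_3, ..., there
   is a power series f = -a + x + ... for which a + b_2 a^2 + ... is a formal
   root.  The linear factor x - r of f shows that r is the a-adic limit of this
   series, so every series in powers of any element converges.  Together with
   Krull's intersection theorem, convergence of geometric series forces a or
   1 - a to be a unit as soon as R is connected; thus a connected R is local,
   and it is complete because its maximal ideal is finitely generated.  A
   Noetherian ring is a finite product of connected ones.  Conversely, the
   preparation theorem over a complete local ring is a contraction argument; it
   gives a polynomial of degree m <= n, which is multiplied by x^(n-m) + 1. *)
Require Import Defs.
From HB Require Import structures.
From mathcomp Require Import all_boot all_order all_algebra.
From mathcomp Require Import generic_quotient ring_quotient boolp classical_sets.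
From mathcomp Require Import ring zify.

Set Implicit Arguments.
Unset Strict Implicit.
Unset Printing Implicit Defensive.

Import GRing.Theory.
Local Open Scope quotient_scope.
Local Open Scope classical_set_scope.
Local Open Scope ring_scope.

(** [L n] lists the first [n] values; as [Q n c] sees [c] only below [n], this list, read with
    default [x0], can replace the sequence. *)
Lemma recursive_choice (T : Type) (Q : nat -> (nat -> T) -> T -> Prop) :
  inhabited T ->
  (forall n c c' v, (forall i, (i < n)%N -> c i = c' i) -> Q n c v -> Q n c' v) ->
  (forall n c, exists v, Q n c v) ->
  exists c, forall n, Q n c (c n).
Proof.
move=> [x0] Qext Qex.
have [v vQ] := choice (fun z : nat * (nat -> T) => Qex z.1 z.2).
pose L := fix L n := if n is n'.+1 then rcons (L n') (v (n', nth x0 (L n'))) else [::].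
have sL n : size (L n) = n by elim: n => //= n IH; rewrite size_rcons IH.
have nL n k i : (i < n)%N -> nth x0 (L (n + k)%N) i = nth x0 (L n) i.
  move=> lin; elim: k => [|k IH]; first by rewrite addn0.
  by rewrite addnS /= nth_rcons sL ltn_addr.
exists (fun i => nth x0 (L i.+1) i) => n.
rewrite /= nth_rcons sL ltnn eqxx.
apply: Qext (vQ (n, nth x0 (L n))) => i /= lin.
by rewrite -(subnKC lin) nL.
Qed.

(** * Limits of series in the powers of one element *)

Section AdicSums.
Variable R : comNzRingType.

(** Convergence without uniqueness: two such [r] differ by an element lying in every ideal
    [(a ^+ k)]. *)
Definition series_limits := forall (a : R) (b : nat -> R),
  exists r, forall k, exists y, r = \sum_(i < k) b i * a ^+ i + a ^+ k * y.

Lemma exprDM_mod (a x y : R) k : exists z, (x + a * y) ^+ k = x ^+ k + a * z.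
Proof.
elim: k => [|k [z IH]]; first by exists 0; rewrite mulr0 addr0.
by exists (x * z + y * x ^+ k + a * y * z); rewrite exprS IH exprS; ring.
Qed.

Lemma sum_exprD_mod (a x y : R) (c : nat -> R) k : exists z,
  \sum_(i < k) c i * (x + a * y) ^+ i = \sum_(i < k) c i * x ^+ i + a * z.
Proof.
elim: k => [|k [z IH]]; first by exists 0; rewrite !big_ord0 mulr0 addr0.
have [w e] := exprDM_mod a x y k.
by exists (z + c k * w); rewrite !big_ord_recr /= IH e; ring.
Qed.

(** Each power above the first contributes [a * x - a * y] times a multiple of [a]. With
    [cancel_unit_mod], two roots modulo [a ^+ k] that are divisible by [a] are congruent modulo
    [a ^+ k]. *)
Lemma sum_exprB_mod (a x y : R) (c : nat -> R) k : c 1%N = 1 ->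
  exists z, \sum_(i < k.+2) c i * (a * x) ^+ i - \sum_(i < k.+2) c i * (a * y) ^+ i
     = (a * x - a * y) * (1 + a * z).
Proof.
move=> c1.
have powB n : exists z, (a * x) ^+ n.+2 - (a * y) ^+ n.+2 = (a * x - a * y) * (a * z).
  elim: n => [|n [z IH]]; first by exists (x + y); rewrite !expr2; ring.
  exists (a * x * z + y * (a * y) ^+ n.+1).
  have -> : (a * x) ^+ n.+3 = (a * x) * ((a * x) ^+ n.+2 - (a * y) ^+ n.+2)
      + (a * x) * (a * y) ^+ n.+2 by rewrite exprS; ring.
  by rewrite IH (exprS _ n.+2) (exprS _ n.+1); ring.
elim: k => [|k [z IH]].
  by exists 0; rewrite !big_ord_recr !big_ord0 /= c1 !expr0 !expr1; ring.
have [w e] := powB k; exists (z + c k.+2 * w).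
rewrite big_ord_recr [X in _ - X]big_ord_recr /=.
by rewrite opprD addrACA IH -[c _ * _ - _]mulrBr e; ring.
Qed.

(* [1 + a * z] is invertible modulo [a ^+ k]. *)
Lemma cancel_unit_mod (a d z y : R) k :
  d * (1 + a * z) = a ^+ k * y -> exists w, d = a ^+ k * w.
Proof.
move=> e; have := subrX1 (- (a * z)) k.
set g := \sum_(i < k) _ => eg.
exists (y * g + d * (- z) ^+ k).
have e2 : (1 + a * z) * g = 1 - (- (a * z)) ^+ k.
  by rewrite -[RHS]opprB eg; ring.
have -> : a ^+ k * (y * g + d * (- z) ^+ k) = (a ^+ k * y) * g + d * (a * - z) ^+ k.
  by rewrite exprMn; ring.
by rewrite -e -mulrA e2 mulrN; ring.
Qed.

(* The coefficients [c] are chosen one at a time so that the partial sums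
   [s k] of the given series are roots of [c] modulo [a ^+ k]. *)
Lemma weierstrass_series_limits : weierstrass_property R -> series_limits.
Proof.
move=> W a b0.
(* The first two coefficients become 0 and 1, so that [s k.+2] is [a] times an element of [1 + a R];
   [sE] records the correction. *)
pose b i := if i is i'.+1 then (if i' is i''.+1 then b0 i else 1) else 0 : R.
pose s k := \sum_(i < k) b i * a ^+ i.
suff [r hr] : exists r, forall k, exists y, r = s k.+2 + a ^+ k.+2 * y.
  have sE k : \sum_(i < k.+2) b0 i * a ^+ i = s k.+2 + (b0 0 + (b0 1 - 1) * a).
    rewrite /s !big_ord_recl /= /bump /= expr0 expr1.
    by under eq_bigr do rewrite /b /=; ring.
  exists (r + (b0 0%N + (b0 1%N - 1) * a)) => -[|[|k]].
  - by exists (r + (b0 0%N + (b0 1%N - 1) * a)); rewrite big_ord0 expr0; ring.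
  - have [y ->] := hr 0%N; exists (b0 1%N + a * y).
    rewrite /s !big_ord_recl !big_ord0 /= /bump /= !exprS expr0; ring.
  - by have [y ->] := hr k; exists y; rewrite sE; ring.
have sS k : s k.+2 = a * (1 + a * \sum_(i < k) b i.+2 * a ^+ i).
  rewrite /s !big_ord_recl /= mul0r add0r mul1r expr1 mulrDr mulr1; congr (_ + _).
  rewrite !mulr_sumr; apply: eq_bigr => i _; rewrite /bump /= !add1n !exprS; ring.
pose div k (x : R) := exists y, x = a ^+ k * y.
pose F (c : nat -> R) k x := \sum_(i < k) c i * x ^+ i.
(* As an implication, the condition can be met for every history [c]; its premise is established by
   induction in [Fs]. *)
pose Q k (c : nat -> R) v := match k with
  | 0 => v = - a | 1 => v = 1
  | k'.+2 => div k (F c k (s k)) -> div k.+1 (F c k (s k.+1) + v * s k.+1 ^+ k) end.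
have [c cQ] : exists c, forall n, Q n c (c n).
  apply: recursive_choice => [|k c c' v e|k c]; first by constructor; exact: 0.
    have eF x : F c k x = F c' k x by apply: eq_bigr => i _; rewrite e.
    by case: k {e} eF => [|[|k]] //= eF; rewrite !eF.
  case: k => [|[|k]]; [by exists (- a) | by exists 1|].
  have [|ndiv] := pselect (div k.+2 (F c k.+2 (s k.+2))); last by exists 0 => /ndiv.
  move=> [y e]; rewrite /Q.
  have -> : s k.+3 = s k.+2 + a ^+ k.+2 * b k.+2.
    by rewrite /s big_ord_recr /= [a ^+ _ * _]mulrC.
  have [z ez] := sum_exprD_mod (a ^+ k.+2) (s k.+2) (b k.+2) c k.+2.
  rewrite [F c _ (_ + _)]ez -/(F _ _ _) e -mulrDr.
  have -> : s k.+2 + a ^+ k.+2 * b k.+2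
     = a * (1 + a * (\sum_(i < k) b i.+2 * a ^+ i + a ^+ k * b k.+2)).
    by rewrite sS 2!exprS; ring.
  set t := (\sum_(_ < _) _ + _).
  rewrite exprMn; have [w ->] := exprDM_mod a 1 t k.+2.
  (* The earlier terms give [a ^+ k.+2 * (y + z)], and [s k.+3 ^+ k.+2] is
     [a ^+ k.+2 * (1 + a * w)], so this coefficient cancels the leading part. *)
  by exists (- (y + z)) => _; exists (- (y + z) * w); rewrite expr1n (exprS _ k.+2); ring.
have c0 : c 0%N = - a by apply: (cQ 0%N).
have c1 : c 1%N = 1 by apply: (cQ 1%N).
have Fs k : div k.+2 (F c k.+2 (s k.+2)).
  elim: k => [|k IH]; last first.
    by have := cQ k.+2 IH; rewrite /F [in X in _ -> X]big_ord_recr.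
  by exists 0; rewrite /F /s !big_ord_recr !big_ord0 /= c0 c1 !expr0 !expr1; ring.
have [|p [u [pm sp [v uv] ef]]] := W 1%N (PowerSeries c).
  apply/seteqP; split=> // x _; exists (fun i => if i == ord0 then 0 else x).
  by rewrite !big_ord_recl big_ord0 /= mul0r c1 mulr1 addr0 add0r.
have p1 : p`_1 = 1 by move/monicP: pm; rewrite lead_coefE sp.
pose r := - p`_0.
have fE k : c k.+1 = u k - r * u k.+1.
  have := congr1 (fun f : powerseries R => f k.+1) ef => /= ->.
  rewrite !big_ord_recl /= /bump /= subSS !subn0 p1 big1 => [|i _].
    by rewrite /r; ring.
  by rewrite nth_default ?mul0r// sp.
have f0 : c 0%N = - r * u 0%N.
  have := congr1 (fun f : powerseries R => f 0%N) ef => /= ->.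
  by rewrite big_ord_recl big_ord0 subn0 addr0 /r opprK.
have u0v0 : u 0%N * v 0%N = 1.
  have := congr1 (fun f : powerseries R => f 0%N) uv => /=.
  by rewrite big_ord_recl big_ord0 addr0.
have ra : r = a * v 0%N.
  have -> : a = r * u 0%N by rewrite -[a]opprK -c0 f0; ring.
  by rewrite -mulrA u0v0 mulr1.
(* The series with coefficients [c] is [(x - r) u], so its partial sums at [r] telescope. *)
have Fr k : F c k.+1 r = - (r ^+ k.+1 * u k).
  elim: k => [|k IH]; first by rewrite /F big_ord_recr big_ord0 /= f0 expr0; ring.
  by rewrite /F big_ord_recr /= -/(F _ _ _) IH fE (exprS _ k.+1); ring.
exists r => k.
have [y ey] := Fs k.
have [z ez] := sum_exprB_mod a (v 0%N) (1 + a * \sum_(i < k) b i.+2 * a ^+ i) k c1.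
move: ez; rewrite -ra -sS -!/(F _ _ _) Fr ey => ez.
have [|w ew] := @cancel_unit_mod a (r - s k.+2) z (- (v 0%N ^+ k.+2 * u k.+1 + y)) k.+2.
  by rewrite -ez ra exprMn; ring.
by exists w; rewrite -ew; ring.
Qed.

End AdicSums.

(** * Ideals of Noetherian rings *)

Section Noetherian.
Variable R : comNzRingType.
Implicit Types (I J : set R) (s : seq R).

Lemma ideal_sum I (J : Type) (r : seq J) (Q : pred J) (F : J -> R) :
  ideal I -> (forall i, Q i -> I (F i)) -> I (\sum_(i <- r | Q i) F i).
Proof. by move=> [I0 ID _] IF; apply: big_ind. Qed.

Lemma idealB I x y : ideal I -> I x -> I y -> I (x - y).
Proof.
by move=> [_ ID IM] Ix Iy; apply: ID => //; rewrite -mulN1r; apply: IM.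
Qed.

Lemma ideal1 I : ideal I -> I 1 -> I = setT.
Proof.
by move=> [_ _ IM] I1; apply/seteqP; split=> // x _; rewrite -[x]mulr1; apply: IM.
Qed.

Lemma generated_ideal n (a : 'I_n -> R) : ideal (generated a).
Proof.
split=> [|x y [c ->] [d ->]|b x [c ->]].
- by exists (fun=> 0); rewrite big1// => i _; rewrite mul0r.
- by exists (fun i => c i + d i); rewrite -big_split; apply: eq_bigr => i _; rewrite mulrDl.
- by exists (fun i => b * c i); rewrite mulr_sumr; apply: eq_bigr => i _; rewrite mulrA.
Qed.

Lemma generated_mem n (a : 'I_n -> R) i : generated a (a i).
Proof.
exists (fun j => (j == i)%:R); rewrite (bigD1 i)//= eqxx mul1r big1 ?addr0//.
by move=> j /negPf->; rewrite mul0r.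
Qed.

Lemma principal_ideal (a : R) : ideal [set x | exists y, x = a * y].
Proof.
split=> [|x y [u ->] [v ->]|b x [u ->]].
- by exists 0; rewrite mulr0.
- by exists (u + v); rewrite mulrDr.
- by exists (b * u); rewrite mulrCA.
Qed.

(** Otherwise choice yields a strictly increasing chain [C] in [F]; the finitely many generators of
    its union all lie in some [C N], where the chain must stop. *)
Lemma noetherian_maximal (F : set (set R)) : noetherian R ->
  (forall I, F I -> ideal I) -> (exists I, F I) ->
  exists I, F I /\ forall J, F J -> I `<=` J -> J = I.
Proof.
move=> nR Fid [I0 FI0]; apply: contrapT => nmax.
have next (I : {I | F I}) : exists J : {I | F I}, projT1 I `<` projT1 J.
  case: I => I FI; apply: contrapT => nJ; apply: nmax; exists I; split=> // J FJ IJ.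
  apply: contrapT => neq; apply: nJ; exists (exist _ J FJ) => /=.
  by split=> // JI; apply: neq; apply/seteqP.
have [g gP] := choice next.
pose C n := projT1 (iter n g (exist _ I0 FI0)).
have Cid n : ideal (C n) by apply: Fid; apply: (projT2 (iter n g _)).
have Clt n : C n `<` C n.+1 by apply: gP.
have Cle n m : (n <= m)%N -> C n `<=` C m.
  move=> /subnKC <-; elim: (m - n)%N => [|k IH]; first by rewrite addn0.
  by rewrite addnS; apply: subset_trans IH _; have [] := Clt (n + k)%N.
have [|n [a ea]] := nR [set x | exists n, C n x].
  split=> [|x y [n Cx] [m Cy]|b x [n Cx]].
  - by exists 0%N; case: (Cid 0%N).
  - exists (maxn n m); case: (Cid (maxn n m)) => _ + _; apply.
      by apply: Cle Cx; rewrite leq_maxl.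
    by apply: Cle Cy; rewrite leq_maxr.
  - by exists n; case: (Cid n) => _ _; apply.
have [N aN] : exists N, forall i, C N (a i).
  have inC i : exists n, C n (a i).
    by have := generated_mem a i; rewrite -ea.
  have [f fP] := choice inC.
  by exists (\max_i f i) => i; apply: Cle (fP i); apply: leq_bigmax.
have [_] := Clt N; apply=> x CNx.
have [c ->] : generated a x by rewrite -ea; exists N.+1.
by apply: ideal_sum (Cid N) _ => i _; case: (Cid N) => _ _; apply.
Qed.

(* [ideal_pow s n] is the [n]-th power of the ideal generated by [s], presented
   through [(a, s)^n = \sum_(j <= n) a^j (s)^(n - j)]. *)
Fixpoint ideal_pow s n : set R := match s with
  | [::] => [set x | (0 < n)%N -> x = 0]
  | a :: s' => [set x | exists e : nat -> R,
      (forall j, (j <= n)%N -> ideal_pow s' (n - j)%N (e j)) /\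
      x = \sum_(j < n.+1) a ^+ j * e j]
  end.

Lemma ideal_pow_ideal s n : ideal (ideal_pow s n).
Proof.
elim: s n => [|a s IH] n.
  split=> [//|x y hx hy n0|b x hx n0]; first by rewrite hx// hy// addr0.
  by rewrite hx// mulr0.
split=> [|x y [e [he ->]] [d [hd ->]]|b x [e [he ->]]].
- exists (fun=> 0); split=> [j _|]; first by case: (IH (n - j)%N).
  by rewrite big1// => j _; rewrite mulr0.
- exists (fun j => e j + d j); split=> [j jn|].
    by case: (IH (n - j)%N) => _ D _; apply: D; [apply: he | apply: hd].
  by rewrite -big_split; apply: eq_bigr => j _; rewrite mulrDr.
- exists (fun j => b * e j); split=> [j jn|].
    by case: (IH (n - j)%N) => _ _; apply; apply: he.
  by rewrite mulr_sumr; apply: eq_bigr => j _; rewrite mulrCA.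
Qed.

Lemma ideal_pow0 s x : ideal_pow s 0 x.
Proof.
elim: s x => [//|a s IH] x; exists (fun=> x); split=> [j|]; first by rewrite leqn0 => /eqP->.
by rewrite big_ord_recl big_ord0 expr0 mul1r addr0.
Qed.

Lemma ideal_pow_mul s n a x : a \in s -> ideal_pow s n x -> ideal_pow s n.+1 (a * x).
Proof.
elim: s n x => [//|b s IH] n x; rewrite inE => /orP[/eqP->|asx] [e [he ->]].
  exists (fun j => if j is j'.+1 then e j' else 0); split=> [[|j] jn|].
  - by case: (ideal_pow_ideal s (n.+1 - 0)%N).
  - by rewrite subSS; apply: he.
  rewrite [RHS]big_ord_recl mulr0 add0r mulr_sumr; apply: eq_bigr => j _ /=.
  by rewrite exprS mulrA.
exists (fun j => if (j <= n)%N then a * e j else 0); split=> [j jn|].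
  case: leqP => jn'; last by case: (ideal_pow_ideal s (n.+1 - j)%N).
  by rewrite subSn//; apply: IH => //; apply: he.
rewrite [RHS]big_ord_recr /= ltnn mulr0 addr0 mulr_sumr; apply: eq_bigr => j _.
by rewrite -ltnS ltn_ord mulrCA.
Qed.

(** In a term [a ^+ j * e j] of total degree at least [N + k], either [j >= k] and [a ^+ j] lies in
    [Q], or the degree left for [s] is at least [N]. *)
Lemma ideal_pow_sub s (Q : set R) : ideal Q ->
  (forall a, a \in s -> exists k, Q (a ^+ k)) ->
  exists N, forall n, (N <= n)%N -> ideal_pow s n `<=` Q.
Proof.
move=> idQ; have [Q0 _ QM] := idQ.
elim: s => [|a s IH] hs; first by exists 1%N => n n0 x /= ->.
have [N hN] : exists N, forall n, (N <= n)%N -> ideal_pow s n `<=` Q.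
  by apply: IH => b bs; apply: hs; rewrite inE bs orbT.
have [|k Qk] := hs a; first by rewrite inE eqxx.
exists (N + k)%N => n Nkn x [e [he ->]]; apply: ideal_sum => // j _.
have [kj|jk] := leqP k j.
  by rewrite -(subnKC kj) exprD -mulrA mulrC; apply: QM.
by apply: QM; apply: (hN (n - j)%N); [lia | apply: he; rewrite -ltnS].
Qed.

(* Krull's intersection theorem: an ideal [Q] maximal subject to
   [Q `&` xR `<=` xP] contains a power of [(s)]. *)
Lemma krull_intersection s (P : set R) x : noetherian R -> ideal P ->
  (forall a, a \in s -> P a) -> (forall n, ideal_pow s n x) ->
  exists2 p, P p & x = x * p.
Proof.
move=> nR idP sP xpow; have [P0 PD PM] := idP.
pose xP := [set y | exists2 p, P p & y = x * p].
have idxP : ideal xP.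
  split=> [|y z [p Pp ->] [q Pq ->]|b y [p Pp ->]].
  - by exists 0; rewrite ?mulr0.
  - by exists (p + q); [apply: PD | rewrite mulrDr].
  - by exists (b * p); [apply: PM | rewrite mulrCA].
pose F := [set Q | [/\ ideal Q, xP `<=` Q & forall z, Q (x * z) -> xP (x * z)]].
have [||Q [[idQ xPQ QxP] Qmax]] := @noetherian_maximal F nR.
- by move=> I [].
- by exists xP; split.
have [Q0 QD QM] := idQ.
(* Then [Q] contains a power of [(s)], hence [x = x * 1], which therefore lies in [xP]. *)
suff pown a : P a -> exists k, Q (a ^+ k).
  have [|N hN] := @ideal_pow_sub s Q idQ; first by move=> a /sP /pown.
  by have /(hN N (leqnn N)) := xpow N; rewrite -[x]mulr1 => /QxP; rewrite mulr1.
move=> Pa.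
(* The colon ideals [(Q : a ^+ k)] increase with [k]; a maximal one gives an exponent where they
   stabilise. *)
have [||C [[k eC] Cmax]] :=
    @noetherian_maximal [set C | exists k, C = [set y | Q (a ^+ k * y)]] nR.
- move=> _ [k ->]; split=> [|y z Qy Qz|b y Qy] /=.
  + by rewrite mulr0.
  + by rewrite mulrDr; apply: QD.
  + by rewrite mulrCA; apply: QM.
- by eexists; exists 0%N; reflexivity.
have Cstab y : Q (a ^+ k.+1 * y) -> Q (a ^+ k * y).
  move=> Qy; suff : C y by rewrite eC.
  rewrite -(Cmax [set y | Q (a ^+ k.+1 * y)])//; first by exists k.+1.
  by rewrite eC => z /= Qz; rewrite exprS -mulrA; apply: QM.
exists k.
(* This is [Q + a ^+ k R]. If [x * z = q + a ^+ k * b], multiplying by [a] puts [a ^+ k.+1 * b] in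
   [Q], so [Cstab] puts [x * z] in [Q], and maximality gives [Q' = Q]. *)
pose Q' := [set y | exists q b, Q q /\ y = q + a ^+ k * b].
suff -> : Q = Q' by exists 0, 1; split=> //; rewrite mulr1 add0r.
have QQ' : Q `<=` Q' by move=> q Qq; exists q, 0; rewrite mulr0 addr0.
apply/esym/Qmax => //; split=> [||z [q [b [Qq e]]]].
- split=> [|y z [q [b [Qq ->]]] [r [c [Qr ->]]]|c y [q [b [Qq ->]]]].
  + by apply: QQ'.
  + by exists (q + r), (b + c); split; [apply: QD | ring].
  + by exists (c * q), (c * b); split; [apply: QM | ring].
- exact: subset_trans QQ'.
apply: QxP; rewrite e; apply: QD => //; apply: Cstab.
have -> : a ^+ k.+1 * b = x * (z * a) - a * q by rewrite exprS mulrA e; ring.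
apply: idealB (QM _ _ Qq) => //; apply: xPQ; exists (z * a) => //.
exact: PM.
Qed.

Lemma ideal_pow1 (a y : R) n : ideal_pow [:: a] n (a ^+ n * y).
Proof.
elim: n => [|n IH]; first exact: ideal_pow0.
by rewrite exprS -mulrA; apply: ideal_pow_mul => //; rewrite inE.
Qed.

(** Krull's theorem for the ideal [a R] kills each of the finitely many generators of the
    intersection by some [1 - a * s i]; the product of these factors has the same form. *)
Lemma krull_principal (a : R) : noetherian R -> exists t,
  forall x, (forall n, exists y, x = a ^+ n * y) -> (1 - a * t) * x = 0.
Proof.
move=> nR.
pose K := [set x : R | forall n, exists y, x = a ^+ n * y].
have idK : ideal K.
  split=> [n|x y hx hy n|b x hx n]; have [] := principal_ideal (a ^+ n) => h0 hD hM.
  - exact: h0.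
  - by apply: hD; [apply: hx | apply: hy].
  - by apply: hM; apply: hx.
have [n [g eK]] := nR K idK.
have ann i : exists t, (1 - a * t) * g i = 0.
  have Kg : K (g i) by rewrite eK; apply: generated_mem.
  have [||p [s ->] e] := @krull_intersection [:: a] _ (g i) nR (principal_ideal a).
  - by move=> b; rewrite inE => /eqP->; exists 1; rewrite mulr1.
  - by move=> k; have [y ->] := Kg k; apply: ideal_pow1.
  by exists s; rewrite mulrBl mul1r [X in _ - X]mulrC -e subrr.
have [s sP] := choice ann.
have [t et] : exists t, \prod_i (1 - a * s i) = 1 - a * t.
  elim/big_ind: _ => [|_ _ [t ->] [u ->]|i _]; first by exists 0; ring.
    by exists (t + u - a * t * u); ring.
  by exists (s i).
exists t => x Kx; have [c ->] : generated g x by rewrite -eK.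
rewrite -et mulr_sumr big1// => i _.
by rewrite (bigD1 i)//= mulrCA mulrAC sP mul0r mulr0.
Qed.

(** Expand each [d n] in powers of the first generator [a] and regroup: the coefficients of [a ^+ j]
    sum to a limit [r j] by induction on [s], and [series_limits] sums the [r j * a ^+ j]. *)
Lemma ideal_pow_limits s (d : nat -> R) : series_limits R ->
  (forall n, ideal_pow s n (d n)) ->
  exists r, forall k, ideal_pow s k (r - \sum_(n < k) d n).
Proof.
move=> sl; elim: s d => [|a s IH] d hd.
  exists (d 0%N) => -[//|k] _; rewrite big_ord_recl big1 ?addr0 ?subrr// => i _.
  exact: hd.
have [e eP] := choice hd.
have [r rP] : exists r : nat -> R, forall j k,
    ideal_pow s k (r j - \sum_(m < k) e (m + j)%N j).
  suff /choice[r] : forall j, exists r, forall k, ideal_pow s k (r - \sum_(m < k) e (m + j)%N j).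
    by exists r.
  move=> j; apply: (IH (fun m => e (m + j)%N j)) => n; have [/(_ j) + _] := eP (n + j)%N.
  by rewrite addnK leq_addl => /(_ isT).
have [x xP] := sl a r; exists x => k.
have [y ->] := xP k.
(* For [j < k] this is the tail of the series for [r j], in the power [k - j]; at [j = k] the power
   is 0 and the remainder [y] is unconstrained. *)
exists (fun j => if (j < k)%N then r j - \sum_(m < k - j) e (m + j)%N j else y).
split=> [j jk|].
  case: ltnP => // kj; have -> : (k - j = 0)%N by lia.
  exact: ideal_pow0.
rewrite big_ord_recr /= ltnn addrAC; congr (_ + _).
under [RHS]eq_bigr do rewrite ltn_ord mulrBr.
rewrite sumrB; congr (_ - _); first by apply: eq_bigr => j _; rewrite mulrC.
elim: k {y} => [|k IHk]; first by rewrite !big_ord0.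
rewrite big_ord_recr /= IHk [RHS]big_ord_recr /= subSnn.
rewrite big_ord_recl big_ord0 addr0 add0n.
have [_ ->] := eP k; rewrite big_ord_recr /= addrA; congr (_ + _).
rewrite -big_split; apply: eq_bigr => j _ /=; rewrite subSn; last exact: ltnW.
by rewrite [in RHS]big_ord_recr mulrDr /= subnK// ltnW.
Qed.

End Noetherian.

(** * Connected rings are complete local *)

Section Adic.
Variable R : comNzRingType.

Lemma idealr_ideal (P : idealr R) : ideal [set` P].
Proof.
by split=> [|x y xP yP|a x xP] /=; [exact: rpred0 | exact: rpredD | exact: idealMr].
Qed.

Lemma idealX0 (P : idealr R) x : x \in idealX P 0.
Proof.
apply/asboolP; exists 1%N, (fun=> x), (fun _ _ => 0); split=> [? []//|].
by rewrite big_ord1 big_ord0 mulr1.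
Qed.

Lemma idealX_mul (P : idealr R) n a x : a \in P -> x \in idealX P n -> a * x \in idealX P n.+1.
Proof.
move=> aP /asboolP[k [c [y [yP ->]]]]; apply/asboolP.
exists k, c, (fun i j => oapp (y i) a (unlift ord0 j)); split=> [i j|].
  by case: unliftP => /=.
rewrite mulr_sumr; apply: eq_bigr => i _.
rewrite big_ord_recl unlift_none /= mulrCA; congr (_ * (_ * _)).
by apply: eq_bigr => j _; rewrite liftK.
Qed.

Lemma idealX_exprM (P : idealr R) n a x j :
  a \in P -> x \in idealX P n -> a ^+ j * x \in idealX P (j + n)%N.
Proof.
move=> aP xP; elim: j => [|j IH]; first by rewrite mul1r.
by rewrite exprS -mulrA addSn; apply: idealX_mul.
Qed.

Lemma ideal_powW (P : idealr R) s n x :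
  {subset s <= P} -> ideal_pow s n x -> x \in idealX P n.
Proof.
elim: s n x => [|a s IH] n x sP.
  case: n => [|n] /= h; first exact: idealX0.
  by rewrite h// -[_ \in _]/(0 \in idealXS P n) idealr0.
case: n => [|n] h; first exact: idealX0.
case: h => e [he ->]; rewrite -[_ \in _]/(_ \in idealXS P n).
apply: rpred_sum => j _; rewrite -[_ \in _]/(_ \in idealX P n.+1).
have jn : (j <= n.+1)%N by rewrite -ltnS.
rewrite -[X in idealX P X](subnKC jn); apply: idealX_exprM; first by apply: sP; rewrite inE eqxx.
by apply: IH (he j jn) => b bs; apply: sP; rewrite inE bs orbT.
Qed.

(** Converse to [ideal_powW] for generators of [P]: the factors of each product are expanded over
    the generators one at a time. *)
Lemma idealXW (P : idealr R) k (g : 'I_k -> R) n x :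
  [set` P] = generated g -> x \in idealX P n -> ideal_pow (codom g) n x.
Proof.
move=> eP /asboolP[m [c [y [yP ->]]]].
have idp k' := ideal_pow_ideal (codom g) k'.
apply: (ideal_sum _ (idp n)) => i _; case: (idp n) => _ _; apply.
elim: n y yP => [|n IH] y yP; first exact: ideal_pow0.
rewrite big_ord_recl.
have [d ->] : generated g (y i ord0) by rewrite -eP /= yP.
rewrite mulr_suml; apply: (ideal_sum _ (idp n.+1)) => j _.
rewrite -mulrA; case: (idp n.+1) => _ _; apply; apply: ideal_pow_mul.
  exact: codom_f.
by apply: (IH (fun i j => y i (lift ord0 j))) => i' j'; apply: yP.
Qed.

Lemma pi_idealXE (P : idealr R) n x y :
  (\pi_({ideal_quot (idealXS P n)}) x = \pi_({ideal_quot (idealXS P n)}) y) <->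
  x - y \in idealX P n.+1.
Proof.
by rewrite -[_ - _ \in _]/(_ \in idealXS P n) Quotient.idealrBE; split=> /eqP.
Qed.

(** Injectivity is separatedness and surjectivity is existence of limits. Index [n] stands for
    [R/P^(n+1)], whence the shifts. *)
Lemma completion_bijectiveP (P : idealr R) : bijective (completion_map P) <->
  (forall x, (forall n, x \in idealX P n.+1) -> x = 0) /\
  (forall z : nat -> R, (forall n, z n.+1 - z n \in idealX P n.+1) ->
     exists r, forall n, r - z n \in idealX P n.+1).
Proof.
split=> [[g gK Kg]|[sep compl]].
  split=> [x xP|z zP].
    apply: (can_inj gK); apply: val_inj; apply: functional_extensionality_dep => n /=.
    by apply/pi_idealXE; rewrite subr0.
  have zcoh : ((fun n => \pi_({ideal_quot (idealXS P n)}) (z n)) : prod_ring (adic_quot P))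
      \in @adic_coherent R P.
    apply/asboolP => n; rewrite quot_mapE; last by move=> x /sub_idealX.
    exact/pi_idealXE.
  exists (g (Completion zcoh)) => n.
  have /(congr1 (fun c => completion_val c n)) /= := Kg (Completion zcoh).
  by move/pi_idealXE.
have inj : injective (completion_map P).
  move=> x y /(congr1 (@completion_val _ _)) e; apply/subr0_eq.
  apply: sep => n; apply/pi_idealXE.
  by have := congr1 (fun c : prod_ring (adic_quot P) => c n) e.
suff /choice[g gK] : forall c, exists x, completion_map P x = c.
  by exists g => // x; apply: inj; rewrite gK.
case=> c cP; pose z n := repr (c n).
have [|r rP] := compl z.
  move=> n; apply/pi_idealXE; rewrite [RHS]reprK.
  by have /asboolP/(_ n) <- := cP; rewrite -[in RHS](reprK (c n.+1)) quot_mapE => // x /sub_idealX.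
exists r; apply: val_inj; apply: functional_extensionality_dep => n /=.
transitivity (\pi_({ideal_quot (idealXS P n)}) (z n)); [exact/pi_idealXE | exact: reprK].
Qed.

Lemma geometric_limit (c : R) : series_limits R ->
  exists r, forall k, exists y, (1 - c) * r - 1 = c ^+ k * y.
Proof.
move=> /(_ c (fun=> 1)) [r rP]; exists r => k; have [y ->] := rP k.
exists ((1 - c) * y - 1).
under eq_bigr do rewrite mul1r; have := subrX1 c k.
set g := \sum_(_ < _) _ => e.
have -> : c ^+ k = 1 + (c - 1) * g by rewrite -e; ring.
by ring.
Qed.

(* [1 - a t] kills the intersection of the powers of [a] and is a unit modulo
   it, so it is an idempotent up to a unit. *)
Lemma connected_unit_or (a : R) : noetherian R -> series_limits R ->
  (forall e : R, e * e = e -> e = 0 \/ e = 1) -> is_unit a \/ is_unit (1 - a).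
Proof.
move=> nR sl conn; have [t tP] := krull_principal a nR.
have [r rP] := geometric_limit (a * t) sl.
(* The second factor lies in every power of [a t R], hence of [a R], so [1 - a * t] kills it. *)
have ur0 : (1 - a * t) * ((1 - a * t) * r - 1) = 0.
  by apply: tP => n; have [y ->] := rP n; exists (t ^+ n * y); rewrite exprMn mulrA.
set u := 1 - a * t in tP ur0 *.
have uur : u * (u * r) = u by apply/subr0_eq; rewrite -ur0 mulrBr mulr1.
have [|ur|ur] := conn (u * r); first by rewrite mulrAC uur.
  by left; exists t; apply/esym/subr0_eq; rewrite -/u -uur ur mulr0.
(* Here [u] is a unit, so the powers of [a R] meet in 0 and the geometric limit [q] is a true
   inverse of [1 - a]. *)
right; have [q qP] := geometric_limit a sl.
exists q; apply/subr0_eq.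
by rewrite -[LHS]mul1r -[X in X * _]ur mulrAC tP ?mul0r.
Qed.

Lemma local_nonunits (P : idealr R) : (forall x, x \in P <-> ~ is_unit x) ->
  local_with_maximal_ideal P.
Proof.
move=> PE.
have unitT (J : set R) x : ideal J -> J x -> is_unit x -> J = setT.
  move=> idJ Jx [y xy]; apply: ideal1 => //; rewrite -xy mulrC.
  by case: idJ => _ _; apply.
have idP := idealr_ideal P.
have PnT : [set` P] <> setT.
  by move/seteqP => [_ /(_ 1 I)] /=; rewrite idealr1.
have subP (J : set R) : ideal J -> J <> setT -> J `<=` [set` P].
  by move=> idJ JnT x Jx; apply/PE => ux; apply: JnT; apply: unitT ux.
split; first split=> // J idJ PJ JnT; first by apply/seteqP; split=> //; apply: subP.
by move=> M [idM MnT Mmax]; apply/esym/Mmax => //; apply: subP.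
Qed.

Lemma connected_complete_local : noetherian R -> series_limits R ->
  (forall e : R, e * e = e -> e = 0 \/ e = 1) -> complete_local R.
Proof.
move=> nR sl conn.
have unitMl (a b : R) : is_unit (a * b) -> is_unit a.
  by move=> [c e]; exists (b * c); rewrite mulrA.
pose S : {pred R} := fun x => `[< ~ is_unit x >].
have cl : idealr_closed S.
  split=> [||a u v /asboolP nu /asboolP nv].
  - by apply/asboolP => -[x]; rewrite mul0r => /esym/eqP; rewrite oner_eq0.
  - by apply/negP => /asboolP; apply; exists 1; rewrite mulr1.
  (* If [(a * u + v) * w = 1], then [a * u * w] and [v * w] sum to 1; one of them is a unit, hence
     so is [u] or [v]. *)
  - apply/asboolP => -[w e].
    have [] := connected_unit_or (a * u * w) nR sl conn.
      by rewrite -mulrA mulrCA => /unitMl.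
    by rewrite -e mulrDl [a * u * w + _]addrC addrK => /unitMl.
pose P : idealr R := HB.pack S (isIdealr.Build R S cl).
have PE x : x \in P <-> ~ is_unit x by split=> /asboolP.
exists P; split; first exact: local_nonunits.
have idP := idealr_ideal P.
have [k [g eP]] := nR _ idP.
have gP : {subset codom g <= P}.
  move=> _ /codomP[i ->]; have := generated_mem g i; by rewrite -eP.
apply/completion_bijectiveP; split=> [x xP|z zP].
  (* Krull gives [x = x * p] with [p] a nonunit; then [1 - p] is a unit and [x] vanishes. *)
  have [|p Pp e] := @krull_intersection R (codom g) _ x nR idP gP.
    by case=> [|n]; [exact: ideal_pow0 | apply: (idealXW eP)].
  have [|[q pq]] := connected_unit_or p nR sl conn; first by move/PE: Pp.
  by rewrite -[x]mulr1 -pq mulrA mulrBr mulr1 -e subrr mul0r.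
(* The first [n.+1] terms sum to [z n]. *)
pose d n := if n is n'.+1 then z n - z n' else z 0%N.
have [|r rP] := @ideal_pow_limits R (codom g) d sl.
  by case=> [|n]; [exact: ideal_pow0 | exact: (idealXW eP (zP n))].
exists r => n; apply: (ideal_powW gP).
have := rP n.+1; congr (ideal_pow _ _ (_ - _)).
elim: n => [|n IH]; first by rewrite big_ord1.
by rewrite big_ord_recr IH /= addrC subrK.
Qed.

End Adic.

(** * Decomposition into connected factors *)

Section Surjection.
Variables (R S : comNzRingType) (phi : {rmorphism R -> S}).
Hypothesis phi_onto : forall y, exists x, phi x = y.

Lemma noetherian_onto : noetherian R -> noetherian S.
Proof.
move=> nR I [I0 ID IM].
have [|n [a ea]] := nR [set x | I (phi x)].
  by split=> [|x y Ix Iy|b x Ix] /=; rewrite ?rmorph0 ?rmorphD ?rmorphM; auto.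
exists n, (phi \o a); apply/seteqP; split=> [y Iy|_ [c ->]].
  have [x ex] := phi_onto y.
  have [c ec] : generated a x by rewrite -ea /= ex.
  exists (phi \o c); rewrite -ex ec rmorph_sum; apply: eq_bigr => i _; exact: rmorphM.
apply: ideal_sum => // i _; apply: IM.
have : generated a (a i) by apply: generated_mem.
by rewrite -ea.
Qed.

Lemma series_limits_onto : series_limits R -> series_limits S.
Proof.
move=> sl a b; have [x <-] := phi_onto a.
have [c cE] := choice (fun n => phi_onto (b n)).
have [r rP] := sl x c; exists (phi r) => k; have [y ->] := rP k; exists (phi y).
rewrite rmorphD rmorphM rmorphXn rmorph_sum; congr (_ + _); apply: eq_bigr => i _.
by rewrite rmorphM rmorphXn; congr (_ * _); apply: cE.
Qed.

End Surjection.

Section Idempotents.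
Variable R : comNzRingType.

Definition primitive_idempotent (e : R) :=
  [/\ e * e = e, e != 0 & forall f, f * f = f -> f * e = f -> f = 0 \/ f = e].

(** Noetherian induction on annihilators: a counterexample [f] with maximal annihilator splits as
    [g + (f - g)], and the decompositions of the two pieces are concatenated. *)
Lemma primitive_decomposition (e : R) : noetherian R -> e * e = e ->
  exists s : seq R, [/\ forall x, x \in s -> primitive_idempotent x /\ x * e = x,
    pairwise (fun x y => x * y == 0) s & \sum_(x <- s) x = e].
Proof.
move=> nR; pose good e := exists s : seq R,
  [/\ forall x, x \in s -> primitive_idempotent x /\ x * e = x,
    pairwise (fun x y => x * y == 0) s & \sum_(x <- s) x = e].
rewrite -/(good e) => ee; apply: contrapT => bad.
pose ann (f : R) := [set x | x * f = 0].
have [||_ [[f [ff fbad ->]] fmax]] := @noetherian_maximal R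
    [set I | exists f, [/\ f * f = f, ~ good f & I = ann f]] nR.
- move=> _ [f [_ _ ->]]; split=> [|x y|a x]; rewrite /ann /=; first by rewrite mul0r.
    by rewrite mulrDl => -> ->; rewrite addr0.
  by rewrite -mulrA => ->; rewrite mulr0.
- by exists (ann e), e.
(* [f - g] kills [g] but not [f], so [ann g] is strictly larger than [ann f]. *)
have split_good g : g * g = g -> g * f = g -> f != g -> good g.
  move=> gg gf fg; apply: contrapT => gbad.
  have := fmax (ann g) (ex_intro _ g (And3 gg gbad erefl)).
  have le : ann f `<=` ann g by move=> x; rewrite /ann /= => xf; rewrite -gf mulrCA xf mulr0.
  move=> /(_ le) /seteqP[/(_ (f - g)) + _].
  rewrite /ann /= !mulrBl ff gf gg [f * g]mulrC gf subrr => /(_ erefl) /eqP.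
  by rewrite subr_eq0 (negPf fg).
apply: fbad; have [f0|f0] := eqVneq f 0.
  by exists [::]; split; rewrite ?big_nil ?f0.
have [prim|nprim] := pselect (primitive_idempotent f).
  exists [:: f]; split; rewrite ?big_seq1// => x; rewrite inE => /eqP->; by [].
have [g [gg gf g0 fg]] : exists g, [/\ g * g = g, g * f = g, g != 0 & f != g].
  apply: contrapT => ng; apply: nprim; split=> // g gg gf.
  have [->|g0] := eqVneq g 0; first by left.
  have [->|fg] := eqVneq f g; first by right.
  by case: ng; exists g.
have fgg : (f - g) * (f - g) = f - g.
  by rewrite mulrBl !mulrBr ff gg gf [f * g]mulrC gf subrr subr0.
have fgf : (f - g) * f = f - g by rewrite mulrBl ff gf.
have gfg : g * (f - g) = 0 by rewrite mulrBr gf gg subrr.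
have [s [sP so es]] := split_good g gg gf fg.
have [|t [tP to et]] := split_good (f - g) fgg fgf.
  by rewrite -subr_eq0 opprB addrCA subrr addr0.
exists (s ++ t); split.
- move=> x; rewrite mem_cat => /orP[/sP[px ex]|/tP[px ex]]; split=> //.
    by rewrite -ex -mulrA gf.
  by rewrite -[in LHS]ex -mulrA fgf.
- rewrite pairwise_cat so to !andbT; apply/allrelP => x y /sP[_ ex] /tP[_ ey].
  by rewrite -ex -ey [y * _]mulrC mulrA -[x * g * _]mulrA gfg mulr0 mul0r.
- by rewrite big_cat /= es et addrC subrK.
Qed.

Lemma annihilator_idealr_closed (e : R) : e != 0 ->
  idealr_closed (fun x => x * e == 0 : bool).
Proof.
move=> e0; split; rewrite ?unfold_in ?mul0r ?mul1r// => a u v.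
by rewrite !unfold_in mulrDl -mulrA => /eqP-> /eqP->; rewrite mulr0 addr0.
Qed.

(** For idempotent [e], the quotient by this ideal is a model of the ring [e R] with identity
    [e]. *)
Definition annihilator (e : R) (e0 : e != 0) : idealr R :=
  HB.pack (fun x => x * e == 0) (isIdealr.Build R _ (annihilator_idealr_closed e0)).

Lemma pi_annihilatorE (e : R) (e0 : e != 0) x y :
  (\pi_({ideal_quot (annihilator e0)}) x = \pi_({ideal_quot (annihilator e0)}) y) <->
  x * e = y * e.
Proof.
have -> : (x * e = y * e) <-> (x - y \in annihilator e0).
  by rewrite [_ \in _]unfold_in mulrBl subr_eq0; split=> /eqP.
by rewrite Quotient.idealrBE; split=> /eqP.
Qed.

End Idempotents.
Section ProductMaps.
Variables (I : Type) (A : I -> comPzRingType) (R : comPzRingType).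

Definition prod_proj i (x : prod_ring A) : A i := x i.

Fact prod_proj_zmod i : zmod_morphism (prod_proj i). Proof. by []. Qed.
Fact prod_proj_monoid i : monoid_morphism (prod_proj i). Proof. by []. Qed.
HB.instance Definition _ i := GRing.isZmodMorphism.Build (prod_ring A) (A i)
  (prod_proj i) (prod_proj_zmod i).
HB.instance Definition _ i := GRing.isMonoidMorphism.Build (prod_ring A) (A i)
  (prod_proj i) (prod_proj_monoid i).

Variable phi : forall i, {rmorphism R -> A i}.

Definition prod_map (x : R) : prod_ring A := fun i => phi i x.

Fact prod_map_zmod : zmod_morphism prod_map.
Proof. by move=> x y; apply: functional_extensionality_dep => i; apply: rmorphB. Qed.
Fact prod_map_monoid : monoid_morphism prod_map.
Proof.
by split=> [|x y]; apply: functional_extensionality_dep => i; [apply: rmorph1 | apply: rmorphM].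
Qed.
HB.instance Definition _ := GRing.isZmodMorphism.Build R (prod_ring A)
  prod_map prod_map_zmod.
HB.instance Definition _ := GRing.isMonoidMorphism.Build R (prod_ring A)
  prod_map prod_map_monoid.

End ProductMaps.

(** If [x] lifts an idempotent of the quotient, then [x * e] is an idempotent of [R] below [e], so
    it is 0 or [e]; the quotient is thus connected. *)
Lemma primitive_factor (R : comNzRingType) (e : R) (e0 : e != 0) :
  noetherian R -> series_limits R -> primitive_idempotent e ->
  complete_local {ideal_quot (annihilator e0)} /\ noetherian {ideal_quot (annihilator e0)}.
Proof.
move=> nR sl [ee _ prim].
set pi := (\pi_({ideal_quot (annihilator e0)}) : {rmorphism R -> {ideal_quot (annihilator e0)}}).
have onto y : exists x, pi x = y by exists (repr y); apply: reprK.
have nA := noetherian_onto onto nR.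
split=> //; apply: connected_complete_local => // [|y yy].
  exact: (series_limits_onto onto).
have [x ex] := onto y; move: yy; rewrite -ex -rmorphM => /pi_annihilatorE xx.
have [|||xe] := prim (x * e).
- by rewrite mulrACA ee xx.
- by rewrite -mulrA ee.
- by left; rewrite -(rmorph0 pi); apply/pi_annihilatorE; rewrite mul0r.
- by right; rewrite -(rmorph1 pi); apply/pi_annihilatorE; rewrite mul1r.
Qed.

Lemma series_limits_product (R : comNzRingType) : noetherian R -> series_limits R ->
  exists (k : nat) (A : 'I_k -> comNzRingType),
    (forall i : 'I_k, complete_local (A i) /\ noetherian (A i)) /\
    ring_isomorphic R (prod_ring (fun i : 'I_k => A i : comPzRingType)).
Proof.
move=> nR sl; have [s [sP so s1]] := primitive_decomposition nR (mulr1 1).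
have sprim (i : 'I_(size s)) : primitive_idempotent s`_i.
  by have [] := sP _ (mem_nth 0 (ltn_ord i)).
have s0 (i : 'I_(size s)) : s`_i != 0 by have [] := sprim i.
pose A (i : 'I_(size s)) : comNzRingType := {ideal_quot (annihilator (s0 i))}.
exists (size s), A; split=> [i|]; first exact: primitive_factor.
pose phi i : {rmorphism R -> (A i : comPzRingType)} := \pi_({ideal_quot (annihilator (s0 i))}).
exists (prod_map phi).
have sij (i j : 'I_(size s)) : s`_i * s`_j = if i == j then s`_i else 0.
  case: eqVneq => [->|]; first by have [] := sprim j.
  rewrite neq_ltn => /orP[] ij; last rewrite mulrC; apply/eqP;
    by move/(pairwiseP 0): so; apply; rewrite ?inE.
have sum1 : \sum_(i < size s) s`_i = 1 by rewrite -s1 (big_nth 0) big_mkord.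
(* Chinese remaindering: arbitrary lifts are glued along orthogonal idempotents of sum 1. *)
exists (fun y : prod_ring (fun i : 'I_(size s) => A i : comPzRingType) =>
  \sum_(i < size s) s`_i * repr (y i)) => [x|y].
  rewrite -[RHS]mulr1 -sum1 mulr_sumr; apply: eq_bigr => i _; rewrite [LHS]mulrC.
  by apply/(pi_annihilatorE (s0 i)); rewrite reprK.
apply: functional_extensionality_dep => j; rewrite -[RHS]reprK.
apply/pi_annihilatorE; rewrite mulr_suml (bigD1 j)//= big1 => [|i /negPf ij].
  by rewrite addr0 mulrAC sij eqxx mulrC.
by rewrite mulrAC sij ij mul0r.
Qed.

(** * Weierstrass preparation over complete local rings *)

Section PowerSeriesFacts.
Variable R : comNzRingType.
Implicit Types f g h : powerseries R.

Lemma coef_psM f g n : (f * g) n = \sum_(i < n.+1) f i * g (n - i)%N.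
Proof. by []. Qed.

(** The equation for each coefficient of the inverse is linear in it, with the unit [f 0] as
    factor. *)
Lemma ps_unit f : is_unit (f 0%N) -> is_unit f.
Proof.
move=> [c fc].
have [|||g gP] := @recursive_choice R (fun n (g : nat -> R) v =>
    \sum_(i < n) g i * f (n - i)%N + v * f 0%N = (n == 0%N)%:R).
- by constructor; exact: 0.
- move=> n g g' v e <-; congr (_ + _); apply: eq_bigr => i _; by rewrite e.
- move=> n g; exists (((n == 0%N)%:R - \sum_(i < n) g i * f (n - i)%N) * c).
  by rewrite -mulrA [c * _]mulrC fc mulr1 addrC subrK.
exists (PowerSeries g); rewrite mulrC; apply: psP => n.
by rewrite coef_psM big_ord_recr /= subnn gP.
Qed.

Lemma ps_polyM (p q : {poly R}) : ps_poly (p * q) = ps_poly p * ps_poly q.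
Proof. by apply: psP => n; rewrite coef_psM /= coefM. Qed.

Lemma coef_psXnM m f n : (ps_poly 'X^m * f) n = if (n < m)%N then 0 else f (n - m)%N.
Proof.
rewrite coef_psM; case: ltnP => mn.
  rewrite big1// => i _; rewrite /= coefXn; case: eqP => [e|_]; last by rewrite mul0r.
  by move: (ltn_ord i); rewrite e; lia.
have mn' : (m < n.+1)%N by [].
rewrite (bigD1 (Ordinal mn'))//= coefXn eqxx mul1r big1 ?addr0// => i.
by rewrite -val_eqE /= coefXn => /negPf->; rewrite mul0r.
Qed.

(** For [k > 0], [x^k + 1] has constant term 1. For [k = 0] it would be 2, possibly not a unit, so 1
    is taken instead. *)
Lemma unit_monic_poly k : exists t : {poly R},
  [/\ t \is monic, size t = k.+1 & is_unit (ps_poly t)].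
Proof.
case: k => [|k].
  exists 1; rewrite monic1 size_poly1; split=> //.
  by apply: ps_unit; exists 1; rewrite /= coef1 mulr1.
exists ('X^(k.+1) + 1%:P); split; first exact: monicXnaddC.
  by rewrite size_XnaddC.
by apply: ps_unit; exists 1; rewrite /= coefD coefXn coefC add0r mulr1.
Qed.

End PowerSeriesFacts.

Section CompleteLocal.
Variables (R : comNzRingType) (P : idealr R).
Hypothesis nonP_unit : forall x, x \notin P -> is_unit x.
Hypothesis separated : forall x, (forall n, x \in idealX P n.+1) -> x = 0.
Hypothesis complete : forall z : nat -> R, (forall n, z n.+1 - z n \in idealX P n.+1) ->
  exists r, forall n, r - z n \in idealX P n.+1.

Lemma idealXD k x y : x \in idealX P k.+1 -> y \in idealX P k.+1 -> x + y \in idealX P k.+1.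
Proof. exact: (@rpredD _ (idealXS P k)). Qed.

Lemma idealX_psM (f h : powerseries R) k n :
  (forall i, f i \in idealX P k) -> (forall i, h i \in P) -> (f * h) n \in idealX P k.+1.
Proof.
move=> fP hP; rewrite coef_psM; apply: (@rpred_sum _ (idealXS P k)) => i _.
by rewrite mulrC; apply: idealX_mul.
Qed.

(* [z |-> 1 - shift m (z * h)] is contracting for the [P]-adic topology. *)
Lemma shift_fixpoint (h : powerseries R) m : (forall i, h i \in P) ->
  exists z : powerseries R, forall n, z n + (z * h) (n + m)%N = (n == 0%N)%:R.
Proof.
move=> hP.
pose T (z : powerseries R) := PowerSeries (fun n => (z * h) (n + m)%N).
pose Z k := iter k (fun z => 1 - T z) 1.
have ZS k n : Z k.+1 n = (n == 0%N)%:R - (Z k * h) (n + m)%N by [].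
have ZP k n : (Z k.+1 - Z k) n \in idealX P k.+1.
  elim: k n => [|k IH] n.
    have -> : (Z 1%N - Z 0%N) n = ((0 - 1) * h) (n + m)%N.
      rewrite sub0r mulNr -[RHS]/(- (1 * h) (n + m)%N).
      rewrite -[LHS]/((n == 0%N)%:R - (1 * h) (n + m)%N - (n == 0%N)%:R); ring.
    by apply: idealX_psM => // i; apply: idealX0.
  have -> : (Z k.+2 - Z k.+1) n = (((Z k - Z k.+1) * h) (n + m)%N).
    rewrite mulrBl -[LHS]/(Z k.+2 n - Z k.+1 n) !ZS.
    rewrite -[RHS]/((Z k * h) (n + m)%N - (Z k.+1 * h) (n + m)%N); ring.
  apply: idealX_psM => // i; rewrite -opprB -[_ \in _]/(- (Z k.+1 - Z k) i \in idealXS P k).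
  by rewrite rpredN; apply: IH.
have [z zP] := choice (fun n => complete (fun k => ZP k n)).
pose z' := PowerSeries z; exists z' => n; apply/subr0_eq/separated => k.
have -> : z' n + (z' * h) (n + m)%N - (n == 0%N)%:R =
    (z' n - Z k.+1 n) + ((z' - Z k) * h) (n + m)%N.
  rewrite ZS mulrBl -[((_ - _ : powerseries R) _)]/((z' * h) (n + m)%N - (Z k * h) (n + m)%N); ring.
apply: idealXD; first by apply: sub_idealX; apply: zP.
by apply: sub_idealX; apply: idealX_psM => // i; apply: zP.
Qed.

(** Write [f = a + x^m v], with [a] the terms below [m] and [w] inverse to [v]. Then
    [z * w * f = z * (a * w) + x^m z], and [shift_fixpoint] provides [z] making the coefficients
    from [m] on equal to 1, 0, 0, and so on. *)
Lemma weierstrass_preparation (f : powerseries R) m :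
  f m \notin P -> (forall i, (i < m)%N -> f i \in P) ->
  exists (p : {poly R}) (u : powerseries R),
    [/\ p \is monic, size p = m.+1, is_unit u & f = ps_poly p * u].
Proof.
move=> fm fP.
pose v := PowerSeries (fun k => f (k + m)%N).
pose a := PowerSeries (fun k => if (k < m)%N then f k else 0).
have fE : f = a + ps_poly 'X^m * v.
  apply: psP => n; rewrite -[RHS]/(a n + (ps_poly 'X^m * v) n) coef_psXnM /=.
  by case: ltnP => mn; rewrite ?addr0// add0r subnK.
have [w vw] : is_unit v by apply/ps_unit/nonP_unit.
have hP i : (a * w) i \in P.
  rewrite coef_psM; apply: rpred_sum => j _; rewrite mulrC idealMr//=.
  by case: ltnP => [/fP//|_]; apply: idealr0.
have [z zE] := shift_fixpoint m hP.
(* The constant term of [z] is congruent to 1 modulo [P]. *)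
have uz : is_unit z.
  apply/ps_unit/nonP_unit; apply/negP => zP; have := zE 0%N; rewrite add0n => e.
  have : (1 : R) \in P.
    rewrite -[1]/((0 == 0)%N%:R) -e rpredD// coef_psM; apply: rpred_sum => j _; exact: idealMr.
  by rewrite idealr1.
pose p := \poly_(i < m.+1) if i == m then 1 else (z * (a * w)) i.
have zwf : z * w * f = ps_poly p.
  have -> : z * w * f = z * (a * w) + ps_poly 'X^m * z.
    by rewrite fE -[X in _ = _ + _ * X]mulr1 -vw; ring.
  apply: psP => n; rewrite -[LHS]/((z * (a * w)) n + (ps_poly 'X^m * z) n).
  rewrite coef_psXnM /= coef_poly ltnS.
  case: ltngtP => nm; first by rewrite addr0.
    have := zE (n - m)%N; rewrite subnK; last exact: ltnW.
    by rewrite addrC => ->; rewrite subn_eq0 leqNgt nm.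
  by have := zE (n - m)%N; rewrite nm subnn add0n addrC.
have [z' zz'] := uz.
exists p, (v * z'); split.
- by rewrite monicE lead_coefE size_poly_eq ?eqxx ?oner_eq0//= coef_poly ltnSn eqxx.
- by rewrite size_poly_eq// eqxx oner_eq0.
- by exists (w * z); rewrite mulrACA vw [z' * _]mulrC zz' mulr1.
- by rewrite -zwf -[LHS]mulr1 -(mulr1 1) -{1}vw -zz'; ring.
Qed.

Lemma complete_local_weierstrass_unit : weierstrass_property R.
Proof.
move=> n f gen.
have [i0 [i0n fi0]] : exists i, (i <= n)%N /\ f i \notin P.
  apply: contrapT => no.
  have [c e] : generated (fun i : 'I_n.+1 => f i) 1 by rewrite gen.
  have : (1 : R) \in P.
    rewrite e rpred_sum// => i _; apply: idealMr; apply: contrapT => /negP fi.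
    by apply: no; exists i; rewrite -ltnS.
  by rewrite idealr1.
have exm : exists i, f i \notin P by exists i0.
case: (ex_minnP exm) => m fm mmin.
have mn : (m <= n)%N by apply: leq_trans i0n; apply: mmin.
have [|p [u [pm sp [u' uu'] ->]]] := weierstrass_preparation fm.
  by move=> i im; apply: contraTT im => fi; rewrite -leqNgt mmin.
have [t [tm st [t' tt']]] := unit_monic_poly R (n - m).
(* The factor [t] raises the degree from [m] to [n]; its inverse is absorbed into the unit. *)
exists (p * t), (t' * u); split.
- by rewrite monicMl.
- by rewrite size_Mmonic ?monic_neq0// sp st; lia.
- by exists (ps_poly t * u'); rewrite mulrACA [t' * _]mulrC tt' uu' mulr1.
- by rewrite ps_polyM -mulrA (mulrA (ps_poly t)) tt' mul1r.
Qed.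

End CompleteLocal.

(** An ideal maximal among the proper ideals containing a nonunit [x] is a maximal ideal, hence
    equals [P]. *)
Lemma local_unit (R : comNzRingType) (P : idealr R) : noetherian R ->
  local_with_maximal_ideal P -> forall x, x \notin P -> is_unit x.
Proof.
move=> nR [_ Punique] x xP; apply: contrapT => nu.
have [||M [[idM Mx MnT] Mmax]] := @noetherian_maximal R
    [set M | [/\ ideal M, M x & M <> setT]] nR.
- by move=> M [].
- exists [set y | exists z, y = x * z]; split; first exact: principal_ideal.
    by exists 1; rewrite mulr1.
  by move/seteqP => [_ /(_ 1 I)] [z e]; apply: nu; exists z.
have eM : M = [set` P].
  apply: Punique; split=> // J idJ MJ JnT; apply: Mmax => //; split=> //; exact: MJ.
by move: Mx; rewrite eM /= (negPf xP).
Qed.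

Lemma complete_local_weierstrass (R : comNzRingType) :
  noetherian R -> complete_local R -> weierstrass_property R.
Proof.
move=> nR [P [locP /completion_bijectiveP[sep compl]]].
exact: (complete_local_weierstrass_unit (local_unit nR locP) sep compl).
Qed.

(** * The Weierstrass property of products, and the equivalence *)

(** The polynomial factors in all components have the same degree [n], so their coefficients
    assemble through [g] into one monic polynomial of degree [n]. *)
Lemma weierstrass_product (R : comNzRingType) (I : Type) (A : I -> comNzRingType) :
  (forall i, weierstrass_property (A i)) ->
  ring_isomorphic R (prod_ring (fun i => A i : comPzRingType)) ->
  weierstrass_property R.
Proof.
move=> WA [F [g Fg gF]] n f gen.
have [phi phiE] : exists phi : forall i, {rmorphism R -> A i}, forall i x, phi i x = F x i.
  by exists (fun i => @prod_proj I (fun i => A i : comPzRingType) i \o F).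
have phig y i : phi i (g y) = y i by rewrite phiE gF.
have phi_inj x y : (forall i, phi i x = phi i y) -> x = y.
  move=> e; apply: (can_inj Fg); apply: functional_extensionality_dep => i.
  by rewrite -[LHS]phiE e phiE.
(* The inverse is recorded beside the unit, so that the inverses are chosen for all [i] at once and
   assemble too. *)
pose factors i (q : {poly A i} * (powerseries (A i) * powerseries (A i))) :=
  [/\ q.1 \is monic, size q.1 = n.+1, q.2.1 * q.2.2 = 1 &
    PowerSeries (fun k => phi i (f k)) = ps_poly q.1 * q.2.1].
have [p pP] : exists p, forall i, factors i (p i).
  suff ex i : exists q, factors i q.
    by exists (fun i => sval (cid (ex i))) => i; apply: svalP.
  have [|p [u [pm sp [v uv] e]]] := WA i n (PowerSeries (fun k => phi i (f k))).
    apply: ideal1; first exact: generated_ideal.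
    have [c e] : generated (fun i : 'I_n.+1 => f i) 1 by rewrite gen.
    exists (fun j => phi i (c j)); rewrite -(rmorph1 (phi i)) e rmorph_sum.
    by apply: eq_bigr => j _; rewrite rmorphM.
  by exists (p, (u, v)).
pose P := \poly_(k < n.+1) g (fun i => (p i).1`_k).
pose lift (c : forall i, powerseries (A i)) : powerseries R :=
  PowerSeries (fun k => g (fun i => c i k)).
pose u := lift (fun i => (p i).2.1); pose v := lift (fun i => (p i).2.2).
have Pcoef k i : phi i P`_k = (p i).1`_k.
  rewrite coef_poly; case: ltnP => kn; first by rewrite phig.
  by rewrite rmorph0 nth_default//; have [_ -> _ _] := pP i.
have Pn : P`_n = 1.
  apply: phi_inj => i; rewrite Pcoef rmorph1; have [/monicP + sp _ _] := pP i.
  by rewrite lead_coefE sp.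
have sP : size P = n.+1.
  apply: size_poly_eq; rewrite -[X in X != 0]/(g _).
  by move: Pn; rewrite coef_poly ltnSn => ->; apply: oner_neq0.
exists P, u; split=> //; first by rewrite monicE lead_coefE sP Pn.
  exists v; apply: psP => k; apply: phi_inj => i; rewrite coef_psM rmorph_sum.
  have [_ _ /(congr1 (fun f : powerseries _ => f k)) + _] := pP i.
  rewrite coef_psM /= rmorph_nat => <-; apply: eq_bigr => j _.
  by rewrite rmorphM !phig.
apply: psP => k; apply: phi_inj => i; rewrite coef_psM rmorph_sum.
have [_ _ _ /(congr1 (fun f : powerseries _ => f k))] := pP i.
rewrite coef_psM /= => ->; apply: eq_bigr => j _.
by rewrite rmorphM Pcoef phig.
Qed.


Theorem theorem1p2 (R : comNzRingType) (hR : noetherian R) :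
  weierstrass_property R <->
  exists (k : nat) (A : 'I_k -> comNzRingType),
    (forall i : 'I_k, complete_local (A i) /\ noetherian (A i)) /\
    ring_isomorphic R (prod_ring (fun i : 'I_k => A i : comPzRingType)).
Proof.
split=> [W|[k [A [cA iso]]]].
  exact: series_limits_product hR (weierstrass_series_limits W).
apply: weierstrass_product iso => i.
by have [cAi nAi] := cA i; apply: complete_local_weierstrass.
Qed.
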